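(* There is an arithmetic term $T_1$ in one variable such that for every natural number $n \geq 2$, the value $T_1(n)$ is equal to the smallest prime dividing $n$.
   Context: $\mathbb{N}$ includes $0$. Arithmetic terms are the expressions, interpreted as functions on $\mathbb{N}$, defined inductively: the constants $0$, $1$ and the variables are arithmetic terms; if $t_1, t_2$ are arithmetic terms, then so are $(t_1 + t_2)$, $(t_1 \mathbin{\dot{-}} t_2)$, $(t_1 * t_2)$, $(t_1 / t_2)$ and $2^{t_1}$. Here $a \mathbin{\dot{-}} b = \max(a-b, 0)$ and $a/b = \lfloor a/b \rfloor$ is the quotient of integer division, with $a/0 := 0$. *)

(* Defs.v *)
From mathcomp Require Import all_boot.

Set Implicit Arguments.
Unset Strict Implicit.
Unset Printing Implicit Defensive.

(* Arithmetic terms whose variables are among x_0, ..., x_(k-1). *)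
Inductive aterm (k : nat) : Type :=
| AZero
| AOne
| AVar of 'I_k
| AAdd of aterm k & aterm k
| ASub of aterm k & aterm k
| AMul of aterm k & aterm k
| ADiv of aterm k & aterm k
| AExp2 of aterm k.

(* On nat, [-] is truncated subtraction and [m %/ 0] is 0 (lemma [divn0]). *)
Fixpoint aeval (k : nat) (x : 'I_k -> nat) (t : aterm k) : nat :=
  match t with
  | AZero => 0
  | AOne => 1
  | AVar i => x i
  | AAdd t1 t2 => aeval x t1 + aeval x t2
  | ASub t1 t2 => aeval x t1 - aeval x t2
  | AMul t1 t2 => aeval x t1 * aeval x t2
  | ADiv t1 t2 => aeval x t1 %/ aeval x t2
  | AExp2 t1 => 2 ^ aeval x t1
  end.

(* Main.v *)
Require Import Defs.
From mathcomp Require Import all_boot.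
From mathcomp Require Import zify.

Set Implicit Arguments.
Unset Strict Implicit.
Unset Printing Implicit Defensive.

(* Write p for the least prime factor of n. Since n/p is the largest proper divisor
   of n, the 2-adic valuation of the sum of 2^(n-e) over the proper divisors e of n
   is n - n/p, from which p is recovered by a division. For a fixed e, the summand
   counts the triples (d, j, i), with d, j, i < 2^n, at which
   (d e - n)^2 + (j 2^e - i)^2 vanishes. To count the zeros v = 0 of this
   exponential polynomial over the box, pack the numbers (2^w - 1) v as digits in
   base 2^(2w) of one integer: a digit has w ones in binary if 0 < v <= 2^w, and none
   if v = 0, so the number of ones of the packed integer gives the count. The packed
   integer is a term, being a combination of sums of i^a q^i; the number of ones of N
   is the 2-adic valuation of C(2N, N); and binomials, gcds and hence 2-adic
   valuations are terms, as they can be read off as digits of products. *)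

(** * Closure of definable functions under the term operations *)

Definition definable (f : nat -> nat) : Prop :=
  exists t : aterm 1, forall n, aeval (fun _ => n) t = f n.

Lemma definable_ext f g : f =1 g -> definable f -> definable g.
Proof. by move=> fg [t tE]; exists t => n; rewrite tE fg. Qed.

Lemma definable_id : definable (fun n => n).
Proof. by exists (AVar ord0). Qed.

Lemma definableD f g :
  definable f -> definable g -> definable (fun n => f n + g n).
Proof. by move=> [s sE] [t tE]; exists (AAdd s t) => n /=; rewrite sE tE. Qed.

Lemma definableB f g :
  definable f -> definable g -> definable (fun n => f n - g n).
Proof. by move=> [s sE] [t tE]; exists (ASub s t) => n /=; rewrite sE tE. Qed.

Lemma definableM f g :
  definable f -> definable g -> definable (fun n => f n * g n).
Proof. by move=> [s sE] [t tE]; exists (AMul s t) => n /=; rewrite sE tE. Qed.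

Lemma definable_divn f g :
  definable f -> definable g -> definable (fun n => f n %/ g n).
Proof. by move=> [s sE] [t tE]; exists (ADiv s t) => n /=; rewrite sE tE. Qed.

Lemma definable_exp2 f : definable f -> definable (fun n => 2 ^ f n).
Proof. by move=> [s sE]; exists (AExp2 s) => n /=; rewrite sE. Qed.

Lemma definable_cst c : definable (fun=> c).
Proof.
elim: c => [|c [t tE]]; first by exists (AZero 1).
by exists (AAdd (AOne 1) t) => n /=; rewrite tE.
Qed.

Lemma definable_modn f g :
  definable f -> definable g -> definable (fun n => f n %% g n).
Proof.
move=> df dg; apply: (@definable_ext (fun n => f n - f n %/ g n * g n)).
  by move=> n; rewrite {1}(divn_eq (f n) (g n)) addKn.
exact: definableB df (definableM (definable_divn df dg) dg).
Qed.

(** The number [m] of summands is fixed, so the sum can be written out as one term. *)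
Lemma definable_sum m (f : nat -> nat -> nat) :
  (forall i, i < m -> definable (f i)) ->
  definable (fun n => \sum_(i < m) f i n).
Proof.
elim: m => [|m IHm] df.
  by apply: definable_ext (definable_cst 0) => n; rewrite big_ord0.
apply: (@definable_ext (fun n => \sum_(i < m) f i n + f m n)).
  by move=> n; rewrite big_ord_recr.
by apply: definableD (df _ _) => //; apply: IHm => i /ltnW; apply: df.
Qed.

(** * Exponentiation with a variable base *)

(** [B] is congruent to [x] modulo [B - x], and the bound makes [x ^ y] the reduced residue. *)
Lemma modn_exp_sub x y B : x ^ y + x < B -> B ^ y %% (B - x) = x ^ y.
Proof.
move=> lt_B; have xB : x < B by apply: leq_ltn_trans lt_B; apply: leq_addl.
rewrite -modnXm -{1}(subnK (ltnW xB)) modnDl modnXm modn_small //; lia.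
Qed.

Lemma definable_exp f g :
  definable f -> definable g -> definable (fun n => f n ^ g n).
Proof.
(* Since [f n ^ g n <= 2 ^ (f n * g n)] and [f n < 2 ^ f n], this exponent makes [2 ^ s n] exceed
   [f n ^ g n + f n]. *)
move=> df dg; pose s n := f n * g n + f n + 1.
apply: (@definable_ext (fun n => 2 ^ (s n * g n) %% (2 ^ s n - f n))) => [n|].
  rewrite expnM modn_exp_sub // /s !expnD expn1.
  have h1 : f n < 2 ^ f n by apply: ltn_expl.
  have h2 : f n ^ g n <= 2 ^ (f n * g n).
    by rewrite expnM; case: (g n) => // k; rewrite leq_exp2r // ltnW.
  have h3 : 0 < 2 ^ (f n * g n) by rewrite expn_gt0.
  nia.
have ds : definable s.
  by do 2?apply: definableD => //; [apply: definableM|apply: definable_cst].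
apply: definable_modn; first by apply/definable_exp2/definableM.
by apply: definableB => //; apply: definable_exp2.
Qed.

(** * Digit extraction, power sums, gcds, binomials and 2-adic valuations *)

(** The bound on the sum of the [a i] rules out carries in base [X]: the terms of degree below [c]
    add up to less than [X ^ c], and those above are multiples of [X ^ c.+1]. *)
Lemma coef_extract (I : finType) (a d : I -> nat) X c :
  \sum_i a i < X ->
  (\sum_i a i * X ^ d i) %/ X ^ c %% X = \sum_(i | d i == c) a i.
Proof.
move=> ltX; have X0 : 0 < X by apply: leq_ltn_trans ltX.
have Xc0 : 0 < X ^ c by rewrite expn_gt0 X0.
rewrite (bigID (fun i => d i < c)) /=.
set low := (X in X + _); rewrite (bigID (fun i => d i == c)) /=.
set mid := (X in _ + (X + _)); set high := (X in _ + (_ + X)).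
have lowE : low < X ^ c.
  rewrite -(ltn_pmul2r X0) -expnSr; apply: (@leq_ltn_trans ((\sum_i a i) * X ^ c)).
    rewrite /low big_distrl big_distrl big_mkcond /=.
    apply: leq_sum => i _; case: ifP => // lt_dc.
    by rewrite -mulnA -expnSr leq_mul2l leq_pexp2l ?orbT.
  by rewrite expnS ltn_pmul2r.
have midE : mid = (\sum_(i | d i == c) a i) * X ^ c.
  rewrite big_distrl /=; apply: eq_big => [i|i /andP[_ /eqP->]] //.
  by case: ltngtP.
have highE : high = (\sum_(i | c < d i) a i * X ^ (d i - c.+1)) * X * X ^ c.
  rewrite -mulnA -expnS big_distrl /=; apply: eq_big => [i|i]; first by case: ltngtP.
  by case: ltngtP => // lt_cd _; rewrite -mulnA -expnD subnK.
rewrite midE highE -mulnDl addnC divnMDl // (divn_small lowE) addn0.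
rewrite addnC modnMDl modn_small //.
apply: leq_ltn_trans ltX; rewrite [leqRHS](bigID (fun i => d i == c)) /=.
exact: leq_addr.
Qed.

Definition powsum a q m := \sum_(i < m) i ^ a * q ^ i.

(** Telescope [(i+1)^a q^(i+1) - i^a q^i] over [i < m] and expand [(i+1)^a]; the boundary term
    [0 ^ a] is [a == 0]. Dividing by [q - 1] gives a recursion on the fixed exponent [a]. *)
Lemma powsumE a q m : 0 < q ->
  (q - 1) * powsum a q m + (q * \sum_(b < a) 'C(a, b) * powsum b q m + (a == 0))
  = m ^ a * q ^ m.
Proof.
move=> q0; elim: m => [|m IHm].
  rewrite {1}/powsum big_ord0 muln0 big1 => [|b _]; last first.
    by rewrite /powsum big_ord0 muln0.
  by case: a => [|a]; rewrite muln0 // exp0n.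
rewrite {1}/powsum big_ord_recr /= -/(powsum a q m).
under eq_bigr do rewrite /powsum big_ord_recr /= -/(powsum _ q m) mulnDr.
rewrite big_split /= mulnDr [X in _ + (X + _)]mulnDr.
have -> : m.+1 ^ a * q ^ m.+1 =
  q * (\sum_(b < a) 'C(a, b) * (m ^ b * q ^ m)) + q * (m ^ a * q ^ m).
  rewrite expnS -add1n expnDn big_ord_recr /= binn mul1n subnn exp1n mul1n.
  rewrite mulnCA mulnDl mulnDr; congr (_ * _ + _).
  rewrite big_distrl /=; apply: eq_bigr => b _.
  by rewrite exp1n mul1n mulnA.
have : (q - 1) * (m ^ a * q ^ m) + m ^ a * q ^ m = q * (m ^ a * q ^ m).
  by rewrite mulnBl mul1n subnK // leq_pmull.
move: (q * (m ^ a * q ^ m)) (m ^ a * q ^ m) ((q - 1) * (m ^ a * q ^ m)) IHm.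
move: ((q - 1) * _) (q * \sum_(b < a) _) (q * \sum_(b < a) _) (nat_of_bool _).
lia.
Qed.

Lemma definable_powsum a q m : (forall n, 1 < q n) ->
  definable q -> definable m -> definable (fun n => powsum a (q n) (m n)).
Proof.
move=> q1 dq dm; elim/ltn_ind: a => a IHa.
apply: (@definable_ext (fun n => (m n ^ a * q n ^ m n -
    (q n * \sum_(b < a) 'C(a, b) * powsum b (q n) (m n) + (a == 0))) %/ (q n - 1))).
  by move=> n; rewrite -powsumE ?addnK ?mulKn ?subn_gt0 // ltnW.
apply: definable_divn; last exact: definableB _ (definable_cst 1).
apply: definableB.
  by apply: definableM; apply: definable_exp => //; apply: definable_cst.
apply: definableD; last exact: definable_cst.
apply: definableM => //.
apply: (@definable_sum a (fun b n => 'C(a, b) * powsum b (q n) (m n))) => b lt_ba.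
by apply: definableM; [apply: definable_cst | apply: IHa].
Qed.

(* The coefficient of X^(ab) in the product of the two geometric sums counts the
   pairs with a i + b j = a b, i <= b, j < a: one for each i in [1, b] such that
   b divides a i. *)
Lemma gcd_coef a b X : 0 < a -> 0 < b -> b.+1 * a < X ->
  powsum 0 (X ^ a) b.+1 * powsum 0 (X ^ b) a %/ X ^ (a * b) %% X = gcdn a b.
Proof.
move=> a0 b0 ltX.
have -> : powsum 0 (X ^ a) b.+1 * powsum 0 (X ^ b) a =
    \sum_(k : 'I_b.+1 * 'I_a) 1 * X ^ (a * k.1 + b * k.2).
  rewrite -(pair_bigA _ (fun (i : 'I__) (j : 'I__) => 1 * X ^ (a * i + b * j))).
  rewrite /powsum /= big_distrl /=.
  apply: eq_bigr => i _; rewrite big_distrr /=; apply: eq_bigr => j _.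
  by rewrite !mul1n -!expnM expnD.
rewrite coef_extract; last by rewrite sum1_card card_prod !card_ord.
rewrite -(pair_big_dep xpredT
  (fun (i : 'I__) (j : 'I__) => a * i + b * j == a * b) (fun _ _ => 1)) /=.
(* For [i = 0] the equation would force [j = a], which is out of range. *)
rewrite big_ord_recl big1 /= => [|j]; last first.
  by rewrite muln0 add0n mulnC eqn_pmul2r // ltn_eqF.
have g0 : 0 < gcdn a b by rewrite gcdn_gt0 a0.
(* The gcd is the number of multiples of [b %/ gcdn a b] in [1, b]. *)
have -> : gcdn a b = b %/ (b %/ gcdn a b) by rewrite divnA ?dvdn_gcdr // mulKn.
rewrite add0n divn_count_dvd big_add1 /= big_mkord; apply: eq_bigr => i _.
rewrite /bump /= add1n.
have -> : (b %/ gcdn a b %| i.+1) = (b %| a * i.+1).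
  rewrite -(@dvdn_pmul2r (gcdn a b)) // divnK ?dvdn_gcdr //.
  by rewrite muln_gcdr dvdn_gcd [b %| _ * b]dvdn_mull // andbT mulnC.
case: (boolP (b %| _)) => [/dvdnP[q qE]|ndv].
  have q1 : 0 < q by rewrite -(ltn_pmul2r b0) -qE mul0n muln_gt0 a0.
  have le_qa : q <= a.
    by rewrite -(leq_pmul2r b0) -qE leq_pmul2l.
  have ltj : a - q < a by lia.
  rewrite (big_pred1 (Ordinal ltj)) // => j /=.
  rewrite -val_eqE /= qE mulnC -mulnDr [a * b]mulnC eqn_pmul2l //; lia.
rewrite big_pred0 // => j; apply: contraNF ndv => /eqP E.
have : b %| a * i.+1 + b * j by rewrite E dvdn_mull.
by rewrite dvdn_addl // dvdn_mulr.
Qed.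

Lemma definable_gcdn f g : (forall n, 0 < f n) -> (forall n, 0 < g n) ->
  definable f -> definable g -> definable (fun n => gcdn (f n) (g n)).
Proof.
move=> f0 g0 df dg; pose X n := 2 ^ ((g n + 1) * f n).
have dX : definable X.
  by apply/definable_exp2/definableM => //; apply: definableD _ (definable_cst 1).
apply: (@definable_ext (fun n => powsum 0 (X n ^ f n) (g n + 1) *
  powsum 0 (X n ^ g n) (f n) %/ X n ^ (f n * g n) %% X n)) => [n|].
  by rewrite addn1 gcd_coef // /X addn1 ltn_expl.
have X1 h : (forall n, 0 < h n) -> forall n, 1 < X n ^ h n.
  move=> h0 n; rewrite /X -expnM -[1]/(2 ^ 0) ltn_exp2l // !muln_gt0 addn1 /=.
  by rewrite f0 h0.
apply: definable_modn => //; apply: definable_divn; last first.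
  by apply: definable_exp => //; apply: definableM.
apply: definableM; apply: definable_powsum => //;
  try exact: X1; try exact: definable_exp.
exact: definableD _ (definable_cst 1).
Qed.

(** The binomial is the middle base-[X] digit of [(X + 1) ^ (2 * f n)], whose coefficients sum to
    [2 ^ (2 * f n) < X]. *)
Lemma definable_central_bin f :
  definable f -> definable (fun n => 'C(2 * f n, f n)).
Proof.
move=> df; pose X n := 2 ^ (2 * f n + 1).
have d2 : definable (fun n => 2 * f n) by exact: definableM (definable_cst 2) df.
have dX : definable X by apply/definable_exp2/definableD => //; apply: definable_cst.
apply: (@definable_ext (fun n => (X n + 1) ^ (2 * f n) %/ X n ^ f n %% X n)) => [n|].
  have -> : (X n + 1) ^ (2 * f n) =
      \sum_(i < (2 * f n).+1) 'C(2 * f n, i) * X n ^ i.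
    by rewrite addnC expnDn; apply: eq_bigr => i _; rewrite exp1n mul1n.
  rewrite coef_extract; last first.
    have -> : \sum_(i < (2 * f n).+1) 'C(2 * f n, i) = 2 ^ (2 * f n).
      by rewrite (expnDn 1 1); apply: eq_bigr => i _; rewrite !exp1n !muln1.
    by rewrite /X ltn_exp2l // addn1.
  have lt_f : f n < (2 * f n).+1 by lia.
  by rewrite (big_pred1 (Ordinal lt_f)) // => i; rewrite -val_eqE.
apply: definable_modn => //; apply: definable_divn; apply: definable_exp => //.
exact: definableD _ (definable_cst 1).
Qed.

(* With T = 2^M - 1, the binomial formula gives (2^k)^M = (1 + T)^k = 1 + k T
   modulo T^2. *)
Lemma log2_exp2 k M : k + 2 <= M ->
  (2 ^ k) ^ M %% (2 ^ M - 1) ^ 2 %/ (2 ^ M - 1) = k.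
Proof.
move=> le_kM; set T := 2 ^ M - 1.
have ltT : k + 1 < T.
  have : M < 2 ^ M by apply: ltn_expl.
  rewrite /T; lia.
have -> : (2 ^ k) ^ M = (T + 1) ^ k.
  by rewrite subnK ?expn_gt0 // -!expnM mulnC.
have -> : (T + 1) ^ k %% T ^ 2 = (k * T + 1) %% T ^ 2.
  elim: (k) => // j IHj; rewrite expnSr -modnMml IHj modnMml.
  by rewrite -[RHS](modnMDl j); congr (_ %% _); rewrite -mulnn; nia.
by rewrite modn_small ?divnMDl ?divn_small ?addn0 //; rewrite -?mulnn; nia.
Qed.

(** As [logn 2 (f n) < f n], the gcd of [f n] and [2 ^ f n] is the exact power of 2 in [f n];
    [log2_exp2] recovers its exponent. *)
Lemma definable_logn2 f : (forall n, 0 < f n) ->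
  definable f -> definable (fun n => logn 2 (f n)).
Proof.
move=> f0 df; pose g n := gcdn (f n) (2 ^ f n).
have dM : definable (fun n => f n + 2) by exact: definableD _ (definable_cst 2).
have dT : definable (fun n => 2 ^ (f n + 2) - 1).
  by apply: definableB _ (definable_cst 1); apply: definable_exp2.
apply: (@definable_ext (fun n =>
  g n ^ (f n + 2) %% (2 ^ (f n + 2) - 1) ^ 2 %/ (2 ^ (f n + 2) - 1))) => [n|].
  have lt_log : logn 2 (f n) < f n by apply: ltn_logl.
  have -> : g n = 2 ^ logn 2 (f n).
    rewrite /g -{1}(partnC 2 (f0 n)) p_part gcdnC Gauss_gcdl.
      by apply/gcdn_idPr; rewrite dvdn_exp2l // ltnW.
    by rewrite coprimeXl // prime_coprime // -p'natE // part_pnat.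
  by rewrite log2_exp2 // leq_add2r ltnW.
have dg : definable g.
  by apply: definable_gcdn => // [n|]; [rewrite expn_gt0 | apply: definable_exp2].
apply: definable_divn => //; apply: definable_modn.
  exact: definable_exp.
by apply: definable_exp => //; apply: definable_cst.
Qed.

(** * Counting binary ones *)

(* By Kummer's theorem, hw N is the number of ones in the binary expansion of N. *)
Definition hw N := logn 2 'C(2 * N, N).

Lemma logn2_fact_double N : logn 2 (2 * N)`! = N + logn 2 N`!.
Proof.
elim: N => [|N IHN]; first by rewrite muln0.
have -> : (2 * N.+1)`! = 2 * N.+1 * ((2 * N).+1 * (2 * N)`!).
  by rewrite [2 * N.+1]mulnSr addn2 !factS.
rewrite [N.+1`!]factS !lognM ?muln_gt0 ?fact_gt0 // IHN.
rewrite (_ : logn 2 (2 * N).+1 = 0); first by rewrite logn_prime //=; lia.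
by apply: logn_coprime; rewrite coprime2n /= mul2n odd_double.
Qed.

(** Legendre's formula for the prime 2, from [(2N)! = C(2N, N) N! N!]. It yields the recursion of
    the binary digit sum for [hw]. *)
Lemma hw_fact N : hw N + logn 2 N`! = N.
Proof.
have := logn2_fact_double N; rewrite -(@bin_fact (2 * N) N); last lia.
rewrite !lognM ?muln_gt0 ?fact_gt0 ?bin_gt0 //; last lia.
rewrite (_ : 2 * N - N = N); last lia.
by rewrite -/(hw N); lia.
Qed.

Lemma hw_double N : hw (2 * N) = hw N.
Proof.
have := hw_fact (2 * N); have := hw_fact N; have := logn2_fact_double N; lia.
Qed.

Lemma hw_doubleS N : hw (2 * N).+1 = (hw N).+1.
Proof.
have := hw_fact (2 * N).+1; have := hw_fact N; have := logn2_fact_double N.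
rewrite factS lognM ?fact_gt0 // (_ : logn 2 (2 * N).+1 = 0); first lia.
by apply: logn_coprime; rewrite coprime2n /= mul2n odd_double.
Qed.

Lemma hw0 : hw 0 = 0.
Proof. by have := hw_fact 0; lia. Qed.

Lemma hwD k a b : b < 2 ^ k -> hw (b + a * 2 ^ k) = hw b + hw a.
Proof.
elim: k b => [|k IHk] b.
  by rewrite expn0 ltnS leqn0 muln1 => /eqP->; rewrite hw0.
rewrite expnS -(odd_double_half b) -mul2n => lt_b.
have lt_b2 : b./2 < 2 ^ k by lia.
case: (odd b); rewrite ?add0n ?add1n.
  by rewrite addSn mulnCA -mulnDr !hw_doubleS IHk.
by rewrite mulnCA -mulnDr !hw_double IHk.
Qed.

(** Subtraction from [2 ^ k - 1] flips all [k] bits. *)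
Lemma hw_compl k b : b < 2 ^ k -> hw b + hw (2 ^ k - 1 - b) = k.
Proof.
elim: k b => [|k IHk] b; first by rewrite expn0 ltnS leqn0 => /eqP->; rewrite hw0.
rewrite expnS -(odd_double_half b) -mul2n => lt_b.
have lt_b2 : b./2 < 2 ^ k by lia.
have := IHk _ lt_b2; case: (odd b); rewrite ?add0n ?add1n.
  have -> : 2 * 2 ^ k - 1 - (2 * b./2).+1 = 2 * (2 ^ k - 1 - b./2) by lia.
  by rewrite hw_double hw_doubleS; lia.
have -> : 2 * 2 ^ k - 1 - 2 * b./2 = (2 * (2 ^ k - 1 - b./2)).+1 by lia.
by rewrite hw_double hw_doubleS; lia.
Qed.

Lemma hw_mul_pred_exp2 k v : v <= 2 ^ k -> hw ((2 ^ k - 1) * v) = k * (v != 0).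
Proof.
case: v => [|v] lt_v; first by rewrite !muln0 hw0.
(* The high block is [v] and the low block is its complement: [k] ones together. *)
have -> : (2 ^ k - 1) * v.+1 = 2 ^ k - 1 - v + v * 2 ^ k by nia.
rewrite hwD; last lia.
by rewrite (addnC (hw _)) hw_compl ?muln1.
Qed.

(** * Packing families of numbers as digits of one integer *)

Definition pack B m (u : nat -> nat) := \sum_(k < m) u k * B ^ k.

Lemma eq_pack B m u v : u =1 v -> pack B m u = pack B m v.
Proof. by move=> uv; apply: eq_bigr => k _; rewrite uv. Qed.

Lemma packD B m u v : pack B m (fun k => u k + v k) = pack B m u + pack B m v.
Proof. by rewrite -big_split; apply: eq_bigr => k _; rewrite mulnDl. Qed.

Lemma packMl B m c u : pack B m (fun k => c * u k) = c * pack B m u.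
Proof. by rewrite /pack big_distrr /=; apply: eq_bigr => k _; rewrite mulnA. Qed.

Lemma packMr B m c u : pack B m (fun k => u k * c) = pack B m u * c.
Proof. by rewrite /pack big_distrl /=; apply: eq_bigr => k _; rewrite mulnAC. Qed.

Lemma pack_powsum B m a r :
  pack B m (fun k => k ^ a * r ^ k) = powsum a (r * B) m.
Proof. by apply: eq_bigr => k _; rewrite expnMn mulnA. Qed.

Lemma pack_lt B m u : (forall k, k < m -> u k < B) -> pack B m u < B ^ m.
Proof.
elim: m => [|m IHm] ltB; first by rewrite /pack big_ord0.
rewrite /pack big_ord_recr expnS /= -/(pack B m u).
have := IHm (fun k km => ltB k (ltnW km)); have := ltB m (ltnSn m); nia.
Qed.

Lemma hw_pack s m u : (forall k, k < m -> u k < 2 ^ s) ->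
  hw (pack (2 ^ s) m u) = \sum_(k < m) hw (u k).
Proof.
elim: m => [|m IHm] ltB; first by rewrite /pack !big_ord0 hw0.
have ltB' k : k < m -> u k < 2 ^ s by move=> km; apply/ltB/ltnW.
rewrite /pack !big_ord_recr /= -/(pack _ m u) -IHm //.
by rewrite -expnM hwD // expnM pack_lt.
Qed.

(** With entries below [2 ^ s], a row of [L] digits in base [2 ^ (s * L ^ k)] stays below
    [2 ^ (s * L ^ k.+1)], the base one level up, so the levels do not overlap. *)
Definition box s n L (f : nat -> nat -> nat -> nat -> nat) :=
  pack (2 ^ (s * L ^ 3)) n (fun e => pack (2 ^ (s * L ^ 2)) L (fun d =>
  pack (2 ^ (s * L ^ 1)) L (fun j => pack (2 ^ (s * L ^ 0)) L (f e d j)))).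

Lemma eq_box s n L f g : (forall e d j i, f e d j i = g e d j i) ->
  box s n L f = box s n L g.
Proof. by move=> fg; do 4!apply: eq_pack => ?. Qed.

Lemma boxD s n L f g :
  box s n L (fun e d j i => f e d j i + g e d j i) = box s n L f + box s n L g.
Proof. by do 4!(rewrite -packD; apply: eq_pack => ?). Qed.

Lemma boxMl s n L c f :
  box s n L (fun e d j i => c * f e d j i) = c * box s n L f.
Proof. by do 4!(rewrite -packMl; apply: eq_pack => ?). Qed.

Definition boxsum n L (f : nat -> nat -> nat -> nat -> nat) :=
  \sum_(e < n) \sum_(d < L) \sum_(j < L) \sum_(i < L) f e d j i.

Lemma hw_box s n L f :
  (forall e d j i, e < n -> d < L -> j < L -> i < L -> f e d j i < 2 ^ s) ->
  hw (box s n L f) = boxsum n L (fun e d j i => hw (f e d j i)).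
Proof.
move=> ltf.
have lt_pack k u : (forall i, i < L -> u i < 2 ^ (s * L ^ k)) ->
    pack (2 ^ (s * L ^ k)) L u < 2 ^ (s * L ^ k.+1).
  by move=> ltu; rewrite expnSr mulnA [2 ^ (_ * L)]expnM pack_lt.
have lt0 e d j i : e < n -> d < L -> j < L -> i < L ->
    f e d j i < 2 ^ (s * L ^ 0) by rewrite muln1; apply: ltf.
rewrite hw_pack => [|e en]; last by do 3!(apply: (lt_pack) => ? ?); apply: lt0.
apply: eq_bigr => e _; rewrite hw_pack => [|d dL]; last first.
  by do 2!(apply: (lt_pack) => ? ?); apply: lt0.
apply: eq_bigr => d _; rewrite hw_pack => [|j jL]; last first.
  by apply: (lt_pack) => ? ?; apply: lt0.
by apply: eq_bigr => j _; rewrite hw_pack // => i iL; apply: lt0.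
Qed.

(** The factor [r ^ e] accommodates the powers of [2 ^ e] in the polynomial to be packed. *)
Definition monom c a r b k l e d j i :=
  c * (e ^ a * r ^ e) * d ^ b * j ^ k * i ^ l.

(** A monomial separates the four variables, so its nested sum is a product of power sums. *)
Lemma box_monom s n L c a r b k l :
  box s n L (monom c a r b k l) =
  c * powsum a (r * 2 ^ (s * L ^ 3)) n * powsum b (2 ^ (s * L ^ 2)) L *
  powsum k (2 ^ (s * L ^ 1)) L * powsum l (2 ^ (s * L ^ 0)) L.
Proof.
have packX B q : pack B L (fun i => i ^ q) = powsum q B L by [].
transitivity (box s n L
    (fun e d j i => c * (e ^ a * r ^ e) * (d ^ b * (j ^ k * i ^ l)))).
  by apply: eq_box => e d j i; rewrite /monom -!mulnA.
transitivity (pack (2 ^ (s * L ^ 3)) n (fun e => c * (e ^ a * r ^ e) *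
   (powsum b (2 ^ (s * L ^ 2)) L * (powsum k (2 ^ (s * L ^ 1)) L *
     powsum l (2 ^ (s * L ^ 0)) L)))).
  apply: eq_pack => e; rewrite -packX -packMr -packMl; apply: eq_pack => d.
  rewrite -packX -packMr -!packMl; apply: eq_pack => j.
  by rewrite -packX -!packMl.
by rewrite packMr packMl pack_powsum !mulnA.
Qed.

Lemma definable_box_monom s c a r b k l : 0 < r -> (forall n, 0 < s n) ->
  definable s -> definable c ->
  definable (fun n => box (s n) n (2 ^ n) (monom (c n) a r b k l)).
Proof.
move=> r0 s0 ds dc.
have dL : definable (fun n => 2 ^ n) by apply/definable_exp2/definable_id.
have dB x : definable (fun n => 2 ^ (s n * (2 ^ n) ^ x)).
  apply/definable_exp2/definableM => //.
  by apply: definable_exp => //; apply: definable_cst.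
have B1 x n : 1 < 2 ^ (s n * (2 ^ n) ^ x).
  by rewrite -[1]/(2 ^ 0) ltn_exp2l // muln_gt0 s0 !expn_gt0.
apply: definable_ext (fun n => esym (box_monom _ _ _ _ _ _ _ _ _)) _.
do ?apply: definableM => //; apply: definable_powsum => //.
- by move=> n; have := B1 3 n; nia.
- exact: definableM (definable_cst r) (dB 3).
- exact: definable_id.
Qed.

(** * Counting the zeros of an exponential polynomial *)

(** This is [(d e - n)^2 + (j 2^e - i)^2], expanded into monomials with the negative ones collected
    in a single subtraction. *)
Definition gap n e d j i :=
  (d * e) ^ 2 + n ^ 2 + ((j * 2 ^ e) ^ 2 + i ^ 2) -
  (2 * (d * e * n) + 2 * (j * 2 ^ e * i)).

(** Two instances of [2xy <= x^2 + y^2]; hence the subtraction in [gap] never truncates. *)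
Lemma gap_leqif n e d j i :
  2 * (d * e * n) + 2 * (j * 2 ^ e * i) <=
  (d * e) ^ 2 + n ^ 2 + ((j * 2 ^ e) ^ 2 + i ^ 2)
  ?= iff (d * e == n) && (j * 2 ^ e == i).
Proof. by apply: leqif_add; apply: nat_Cauchy. Qed.

Lemma gap_eq0 n e d j i : (gap n e d j i == 0) = (d * e == n) && (j * 2 ^ e == i).
Proof. by rewrite subn_eq0 (geq_leqif (gap_leqif _ _ _ _ _)). Qed.

(** Each of the four squares is at most [(2 ^ n) ^ 4]. *)
Lemma gap_le n e d j i : e < n -> d < 2 ^ n -> j < 2 ^ n -> i < 2 ^ n ->
  gap n e d j i <= 2 ^ (4 * n + 2).
Proof.
move=> en dL jL iL; have nL : n < 2 ^ n by apply: ltn_expl.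
have eL : 2 ^ e <= 2 ^ n by rewrite leq_exp2l // ltnW.
apply: leq_trans (leq_subr _ _) _; rewrite expnD mulnC (mulnC 4) expnM.
move: eL nL dL jL iL; move: (2 ^ e) (2 ^ n) => E L.
have sq x y : x <= y -> x ^ 2 <= y ^ 2 by move=> ?; rewrite leq_exp2r.
move=> eL nL dL jL iL.
have h1 : (d * e) ^ 2 <= (L * L) ^ 2 by apply/sq/leq_mul; lia.
have h2 : (j * E) ^ 2 <= (L * L) ^ 2 by apply/sq/leq_mul; lia.
have h3 : n ^ 2 <= (L * L) ^ 2 by apply/sq; nia.
have h4 : i ^ 2 <= (L * L) ^ 2 by apply/sq; nia.
have -> : L ^ 4 = (L * L) ^ 2 by rewrite mulnn -expnM.
lia.
Qed.

Lemma definable_box_gap s : (forall n, 0 < s n) -> definable s ->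
  definable (fun n => box (s n) n (2 ^ n) (gap n)).
Proof.
move=> s0 ds.
(* [M] packs the negative monomials and [P] the positive ones; [(2 ^ e) ^ 2] enters [P] as
   [4 ^ e]. *)
pose M n := box (s n) n (2 ^ n) (monom (2 * n) 1 1 1 0 0) +
            box (s n) n (2 ^ n) (monom 2 0 2 0 1 1).
pose P n := box (s n) n (2 ^ n) (monom 1 2 1 2 0 0) +
            box (s n) n (2 ^ n) (monom (n ^ 2) 0 1 0 0 0) +
            (box (s n) n (2 ^ n) (monom 1 0 4 0 2 0) +
             box (s n) n (2 ^ n) (monom 1 0 1 0 0 2)).
have d1 c : definable (fun=> c) by apply: definable_cst.
have dn := definable_id.
apply: (@definable_ext (fun n => P n - M n)) => [n|]; last first.
  have dm := definable_box_monom.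
  apply: definableB; repeat (apply: definableD || apply: dm) => //.
  exact: definable_exp.
suff -> : P n = box (s n) n (2 ^ n) (gap n) + M n by rewrite addnK.
rewrite /P /M -!boxD; apply: eq_box => e d j i.
rewrite /monom !exp1n !expn0 !expn1 !muln1 !mul1n.
have -> : 4 ^ e = (2 ^ e) ^ 2 by rewrite expnAC.
have := (gap_leqif n e d j i).1; rewrite /gap !expnMn; nia.
Qed.

Definition cofactor_sum n := \sum_(e < n) ((0 < e) && (e %| n)) * 2 ^ (n - e).

Lemma sum_eq_ord (x m : nat) : \sum_(i < m) (x == i) = (x < m).
Proof.
case: ltnP => [lt_xm|le_mx].
  rewrite (bigD1 (Ordinal lt_xm)) //= eqxx big1 // => i.
  by rewrite -val_eqE /= eq_sym => /negPf->.
by rewrite big1 // => i _; rewrite gtn_eqF // (leq_trans _ le_mx).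
Qed.

Lemma sum_lt_ord x m : x <= m -> \sum_(i < m) (i < x) = x.
Proof.
move=> le_xm.
rewrite (eq_bigr (fun i : 'I_m => if i < x then 1 else 0)) => [|i _]; last first.
  by case: ltnP.
by rewrite -big_mkcond (big_ord_narrow le_xm) sum1_card card_ord.
Qed.

(** For a positive divisor [e] of [n], [d] must be [n / e], and [i = j 2^e < 2^n] leaves [2^(n-e)]
    choices of [j]. *)
Lemma sum_gap_eq0 n :
  boxsum n (2 ^ n) (fun e d j i => gap n e d j i == 0) = cofactor_sum n.
Proof.
apply: eq_bigr => e _.
transitivity (\sum_(d < 2 ^ n) (d * e == n) * 2 ^ (n - e)).
  apply: eq_bigr => d _.
  transitivity ((d * e == n) * \sum_(j < 2 ^ n) \sum_(i < 2 ^ n) (j * 2 ^ e == i)).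
    rewrite big_distrr /=; apply: eq_bigr => j _.
    rewrite big_distrr /=; apply: eq_bigr => i _.
    by rewrite gap_eq0 mulnb.
  congr (_ * _); under eq_bigr do rewrite sum_eq_ord.
  rewrite -[RHS](@sum_lt_ord _ (2 ^ n)); last by rewrite leq_exp2l // leq_subr.
  apply: eq_bigr => j _; congr nat_of_bool.
  rewrite -(@ltn_pmul2r (2 ^ e) j) ?expn_gt0 // -expnD subnK //.
  exact/ltnW/ltn_ord.
rewrite -big_distrl /=; congr (_ * _).
case: (posnP e) => [->|e0] /=.
  by rewrite big1 // => d _; rewrite muln0 ltn_eqF // (leq_ltn_trans _ (ltn_ord e)).
case: (boolP (e %| n)) => [/dvdnP[q qE]|ndv].
  have lt_q : q < 2 ^ n.
    by apply: leq_ltn_trans (ltn_expl n _); rewrite // qE leq_pmulr.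
  transitivity (nat_of_bool (q < 2 ^ n)); last by rewrite lt_q.
  rewrite -sum_eq_ord; apply: eq_bigr => d _.
  by rewrite -[q == _](eqn_pmul2r e0) -qE eq_sym.
rewrite big1 // => d _; apply/eqP; rewrite eqb0.
by apply: contraNN ndv => /eqP qE; apply/dvdnP; exists d.
Qed.

(** The box has [n * (2 ^ n) ^ 3] points, and each nonzero of [gap] contributes [w] ones. Digits of
    width [2 * w] suffice because [(2 ^ w - 1) * 2 ^ w < 2 ^ (2 * w)]. *)
Lemma cofactor_sum_hw n (w := 4 * n + 2) :
  cofactor_sum n =
  n * (2 ^ n) ^ 3 - hw ((2 ^ w - 1) * box (2 * w) n (2 ^ n) (gap n)) %/ w.
Proof.
have w0 : 0 < w by rewrite /w addn2.
rewrite -boxMl hw_box => [|e d j i en dL jL iL]; last first.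
  have := gap_le en dL jL iL; rewrite -/w mul2n -addnn expnD.
  have : 0 < 2 ^ w by rewrite expn_gt0.
  nia.
set S := boxsum _ _ _.
pose T := boxsum n (2 ^ n) (fun e d j i => gap n e d j i != 0).
have -> : S = w * T.
  rewrite /S /T /boxsum; do 4!(rewrite big_distrr /=; apply: eq_bigr => ? _).
  by rewrite hw_mul_pred_exp2 // gap_le.
rewrite mulKn // -sum_gap_eq0.
suff <- : boxsum n (2 ^ n) (fun e d j i => gap n e d j i == 0) + T = n * (2 ^ n) ^ 3.
  by rewrite addnK.
have -> : n * (2 ^ n) ^ 3 = boxsum n (2 ^ n) (fun _ _ _ _ => 1).
  by rewrite /boxsum !sum_nat_const !card_ord muln1 !expnS expn0 muln1.
rewrite /T /boxsum; do 4!(rewrite -big_split /=; apply: eq_bigr => ? _).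
by case: eqP.
Qed.

Lemma definable_cofactor_sum : definable cofactor_sum.
Proof.
pose w n := 4 * n + 2.
have dw : definable w.
  apply: definableD _ (definable_cst 2).
  exact: definableM (definable_cst 4) definable_id.
have dL : definable (fun n => 2 ^ n) by apply/definable_exp2/definable_id.
apply: (definable_ext (fun n => esym (cofactor_sum_hw n))).
apply: definableB.
  apply: definableM definable_id _.
  by apply: definable_exp => //; apply: definable_cst.
apply: definable_divn => //.
apply: definable_logn2 => [n|]; first by rewrite bin_gt0 leq_pmull.
apply: definable_central_bin; apply: definableM.
  by apply: definableB _ (definable_cst 1); apply: definable_exp2.
apply: (@definable_box_gap (fun n => 2 * w n)) => [n|]; first by rewrite /w; lia.
exact: definableM (definable_cst 2) dw.
Qed.

(** * Recovering the least prime factor from a valuation *)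

(** The complementary divisor [n / e] exceeds 1, so it is at least [pdiv n]. *)
Lemma leq_div_pdiv e n : e %| n -> e < n -> e <= n %/ pdiv n.
Proof.
case/dvdnP=> f -> lt_e; have f1 : 1 < f by case: f lt_e => [|[|f]]; lia.
rewrite leq_divRL ?pdiv_gt0 // mulnC leq_mul2r; apply/orP; right.
by rewrite pdiv_min_dvd // dvdn_mulr.
Qed.

(** The largest proper divisor [q] gives the least exponent [n - q], attained once; all other
    summands, [2 ^ n] included, are divisible by [2 ^ (n - q).+1]. *)
Lemma logn2_cofactor_sum n : 1 < n ->
  logn 2 (cofactor_sum n + 2 ^ n) = n - n %/ pdiv n.
Proof.
move=> n1; have n0 := ltnW n1.
have p1 : 1 < pdiv n by apply/prime_gt1/pdiv_prime.
set q := n %/ pdiv n.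
have q0 : 0 < q by rewrite divn_gt0 ?pdiv_gt0 // pdiv_leq.
have qn : q < n by rewrite ltn_Pdiv.
have qdv : q %| n by rewrite dvdn_div ?pdiv_dvd.
rewrite /cofactor_sum (bigD1 (Ordinal qn)) //= q0 qdv mul1n.
set R := \sum_(e < n | _) _.
have /dvdnP[k kE] : 2 ^ (n - q).+1 %| R + 2 ^ n.
  rewrite dvdn_add // ?dvdn_exp2l //; last lia.
  apply: dvdn_sum => e; rewrite -val_eqE /= => neq.
  case: (boolP (_ && _)) => [/andP[e0 edv]|_]; rewrite ?mul0n ?dvdn0 //.
  rewrite mul1n dvdn_exp2l //.
  by have := leq_div_pdiv edv (ltn_ord e); move: neq; rewrite -/q; lia.
rewrite -addnA kE.
have -> : 2 ^ (n - q) + k * 2 ^ (n - q).+1 = 2 ^ (n - q) * (k.*2).+1.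
  by rewrite expnS -mul2n; lia.
rewrite lognM ?expn_gt0 // pfactorK // (@logn_coprime 2) ?addn0 //.
by rewrite coprime2n /= odd_double.
Qed.

Theorem theorem3p1 :
  exists T1 : aterm 1, forall n : nat, 2 <= n -> aeval (fun _ => n) T1 = pdiv n.
Proof.
have [t tE] : definable (fun n => n %/ (n - logn 2 (cofactor_sum n + 2 ^ n))).
  apply: definable_divn definable_id _; apply: definableB definable_id _.
  (* The summand [2 ^ n] keeps the argument positive also for [n < 2], where [cofactor_sum n]
     vanishes. *)
  apply: definable_logn2 => [n|]; first by rewrite addn_gt0 expn_gt0 orbT.
  apply: definableD definable_cofactor_sum _.
  exact/definable_exp2/definable_id.
exists t => n n1; rewrite tE logn2_cofactor_sum // subKn ?leq_div //.
by rewrite divnA ?pdiv_dvd // mulKn // ltnW.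
Qed.
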